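(* The classical regular polyhedra (tetrahedron, cube, octahedron, dodecahedron, icosahedron) retain their automorphism groups when reduced to $\mathbb{F}_p$, $p$ a prime, whenever this reduction is defined, except that the cube in $\mathbb{F}_2$ has automorphism group $S_3$ (the symmetric group on three letters). Here the reduction is defined except when $p=2,3$ for the tetrahedron and the octahedron, always for the cube, except when $p=2,3,5$ for the dodecahedron, and except when $p=2,5$ for the icosahedron.
   Context: For a ring $R$, regular polyhedra over $R$ are defined by substituting elements $x,y\in R$ for $\cos\theta$ and $\cos\gamma$ in the following universal formulas for the rotations about a vertex, an edge and a face, viewed as matrices in $\mathrm{GL}(3,R)$: $$\rho_v=\begin{bmatrix}1 & 1-x & (1-x)(1-y)\\ 0&-1&-1+y\\ 0&1+x&-1+(1+x)(1-y)\end{bmatrix},\quad \rho_e=\begin{bmatrix}-1&0&0\\2&1&1-y\\0&0&-1\end{bmatrix},\quad \rho_f=\begin{bmatrix}-1&-1+x&0\\2&1-2x&0\\0&1+x&1\end{bmatrix}.$$ The automorphism group is the (orientation-preserving) group generated by $\rho_v,\rho_e,\rho_f$. For a classical regular polyhedron one takes $x=\cos\theta$ and $y=\cos\gamma$, where $\theta$ is the angle of each face and $\gamma$ is the dihedral angle between two adjacent faces. The values $(\cos\theta,\cos\gamma)$ are: - tetrahedron: $(\tfrac12,\tfrac13)$; - cube: $(0,0)$; - octahedron: $(\tfrac12,-\tfrac13)$; - dodecahedron: $(\tfrac{1-\sqrt5}{4},-\tfrac{\sqrt5}{5})$; - icosahedron: $(\tfrac12,-\tfrac{\sqrt5}{3})$.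 The automorphism groups of the original polyhedra are $A_4$ for the tetrahedron, $S_4$ for the cube and octahedron, and $A_5$ for the dodecahedron and icosahedron. Reducing a polyhedron to $\mathbb{F}_p$ means reducing the parameters $\cos\theta,\cos\gamma$ in these matrices modulo $p$.
   Formalization: The formal exceptional primes are corrected to 2, 5 for the dodecahedron and 2, 3 for the icosahedron (for which 9y²=5 has no solution mod 3); reduction to F_p is read as reduction into a finite field of characteristic p, since √5 need not lie in F_p. *)

(* Defs.v *)
From HB Require Import structures.
From mathcomp Require Import all_boot all_order all_algebra.
From mathcomp Require Import all_fingroup all_solvable all_field.
From mathcomp Require Import ring.

Set Implicit Arguments.
Unset Strict Implicit.
Unset Printing Implicit Defensive.

Import GRing.Theory Num.Theory.
Local Open Scope ring_scope.

Definition mx3 (R : nzRingType) (rows : seq (seq R)) : 'M[R]_3 :=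
  \matrix_(i, j) (nth [::] rows i)`_j.

(* x and y stand for the cosines of the face angle and of the dihedral angle. *)
Definition rho_v (R : nzRingType) (x y : R) : 'M[R]_3 :=
  mx3 [:: [:: 1; 1 - x; (1 - x) * (1 - y)];
          [:: 0; -1; -1 + y];
          [:: 0; 1 + x; -1 + (1 + x) * (1 - y)]].

Definition rho_e (R : nzRingType) (x y : R) : 'M[R]_3 :=
  mx3 [:: [:: -1; 0; 0];
          [:: 2; 1; 1 - y];
          [:: 0; 0; -1]].

Definition rho_f (R : nzRingType) (x y : R) : 'M[R]_3 :=
  mx3 [:: [:: -1; -1 + x; 0];
          [:: 2; 1 - 2 * x; 0];
          [:: 0; 1 + x; 1]].

Lemma det_mx3 (R : comNzRingType) (a b c d e f g h k : R) :
  \det (mx3 [:: [:: a; b; c]; [:: d; e; f]; [:: g; h; k]]) =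
  a * (e * k - f * h) - b * (d * k - f * g) + c * (d * h - e * g).
Proof.
do 2 rewrite !(expand_det_row _ ord0) !big_ord_recl !big_ord0 /cofactor.
by rewrite !det_mx11 !mxE /= /bump /=; ring.
Qed.

Lemma rho_v_unit (R : comUnitRingType) (x y : R) :
  rho_v x y \is a GRing.unit.
Proof.
rewrite -[_ \is a _]/(_ \in unitmx) unitmxE det_mx3 [X in X \is a _](_ : _ = 1).
  exact: unitr1.
by ring.
Qed.

Lemma rho_e_unit (R : comUnitRingType) (x y : R) :
  rho_e x y \is a GRing.unit.
Proof.
rewrite -[_ \is a _]/(_ \in unitmx) unitmxE det_mx3 [X in X \is a _](_ : _ = 1).
  exact: unitr1.
by ring.
Qed.

Lemma rho_f_unit (R : comUnitRingType) (x y : R) :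
  rho_f x y \is a GRing.unit.
Proof.
rewrite -[_ \is a _]/(_ \in unitmx) unitmxE det_mx3 [X in X \is a _](_ : _ = 1).
  exact: unitr1.
by ring.
Qed.

Definition aut_group (R : finComUnitRingType) (x y : R) : {group {'GL_3[R]}} :=
  <<[set FinRing.Unit (rho_v_unit x y);
         FinRing.Unit (rho_e_unit x y);
         FinRing.Unit (rho_f_unit x y)]>>%G.

Inductive polyhedron :=
  Tetrahedron | Cube | Octahedron | Dodecahedron | Icosahedron.

Definition cos_face (P : polyhedron) : algC :=
  match P with
  | Cube => 0
  | Dodecahedron => (1 - sqrtC 5) / 4
  | Tetrahedron | Octahedron | Icosahedron => 1 / 2
  end.

Definition cos_dihedral (P : polyhedron) : algC :=
  match P with
  | Tetrahedron => 1 / 3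
  | Cube => 0
  | Octahedron => - (1 / 3)
  | Dodecahedron => - (sqrtC 5 / 5)
  | Icosahedron => - (sqrtC 5 / 3)
  end.

(* (x', y') is the image of (x, y) under a ring morphism to F from a subring A
   of algC containing x and y; A is given by an injective morphism into algC.
   When p \in [pchar F], this is reduction modulo a prime above p.  F may be
   larger than the prime field, because 5 need not be a square modulo p. *)
Definition reduces_to (F : fieldType) (x y : algC) (x' y' : F) : Prop :=
  exists (A : comNzRingType) (iota : {rmorphism A -> algC})
         (f : {rmorphism A -> F}) (a b : A),
    [/\ injective iota, iota a = x, iota b = y, f a = x' & f b = y'].

Definition polyhedron_reduction (P : polyhedron) (F : fieldType) (x y : F) :=
  reduces_to (cos_face P) (cos_dihedral P) x y.

Definition reduction_defined (P : polyhedron) (p : nat) : Prop :=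
  exists (F : finFieldType) (x y : F),
    p \in [pchar F] /\ polyhedron_reduction P x y.

(* With X = cos_face and Y = cos_dihedral: the dodecahedron satisfies
   4 X^2 - 2 X - 1 = 0 and 5 Y^2 = 1, which have no solution modulo 2 and 5
   respectively, but reduces to F_9; the icosahedron satisfies 2 X = 1 and
   9 Y^2 = 5, the latter without solution modulo 3, and reduces to (1/2, 0)
   modulo 5.  The published lists, 2, 3, 5 for the dodecahedron and 2, 5 for
   the icosahedron, are inconsistent with these values. *)
Definition bad_primes (P : polyhedron) : seq nat :=
  match P with
  | Cube => [::]
  | Dodecahedron => [:: 2; 5]
  | Tetrahedron | Octahedron | Icosahedron => [:: 2; 3]
  end%N.

Definition isog_classical_aut (P : polyhedron) (gT : finGroupType)
    (G : {group gT}) : Prop :=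
  match P with
  | Tetrahedron => G \isog 'Alt_('I_4)
  | Cube | Octahedron => G \isog 'Sym_('I_4)
  | Dodecahedron | Icosahedron => G \isog 'Alt_('I_5)
  end.

(* Main.v *)
Require Import Defs.
From HB Require Import structures.
From mathcomp Require Import all_boot all_order all_algebra.
From mathcomp Require Import all_fingroup all_solvable all_field.
From mathcomp Require Import ring.

Set Implicit Arguments.
Unset Strict Implicit.
Unset Printing Implicit Defensive.

Import GRing.Theory Num.Theory.
Local Open Scope ring_scope.

(** For every x and y, rho_v * rho_e * rho_f = 1 and rho_e ^+ 2 = 1, so the
    automorphism group is a quotient of a triangle group (2, 3, n) as soon as
    one of rho_v, rho_f has order 3 and the other order n.  These orders are
    read off the characteristic polynomials ('X - 1) * ('X^2 - t * 'X + 1): for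
    the five polyhedra n = 3, 4, 4, 5, 5, and n = 2 for the cube in
    characteristic 2.  For n = 2, 3, 4, 5 a group generated by a and c with a,
    c, a * c of orders exactly 2, n, 3 has order 12 n / (6 - n), hence any two
    such groups are isomorphic: both are projections of the subgroup of their
    product generated by the pairs of generators, which has the same order.  It
    remains to exhibit such permutations in S_3, A_4, S_4 and A_5.

    Conversely, when p is not a bad prime, both cosines lie in the ring
    Z_(p)[sqrt 5], which maps to any field of characteristic p that contains a
    square root of 5. *)

(** * Triangle groups *)

Section Triangle.
Local Open Scope nat_scope.
Local Open Scope group_scope.

(** In a finite group every element generated by [A] is a product of elements of [A], without
    inverses, so closure under right multiplication by generators suffices. *)
Lemma gen_sub_closed (gT : finGroupType) (A X : {set gT}) :
  1 \in X -> {in X & A, forall x y, x * y \in X} -> <<A>> \subset X.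
Proof.
move=> X1 XA; apply/subsetP=> _ /gen_prodgP[m [f fA ->]].
elim: m f fA => [|m IHm] f fA; first by rewrite big_ord0.
by rewrite big_ord_recr; apply: XA => //; apply: IHm => i.
Qed.

Lemma card_mulg_leq (gT : finGroupType) (A B : {set gT}) :
  #|A * B| <= #|A| * #|B|.
Proof. by rewrite -imset_mulgm -cardsX leq_imset_card. Qed.

Section Relations.

Variables (gT : finGroupType) (a c : gT) (n : nat).
Hypotheses (a2 : #[a] = 2) (cn : #[c] = n) (ac3 : #[a * c] = 3).

(** [D g] is the double coset of [g] modulo [C]. The group will be covered by [C] and [D a] for n =
    2, 3, by these and [C :* u] for n = 4 (4 + 16 + 4), and by [C], [D a], [D u], [C :* t] for n = 5
    (5 + 25 + 25 + 5). *)
Let C := <[c]>.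
Let D g := (C :* g) * C.
Let u := a * c * c * a.
Let t := u * c^-1 * c^-1 * a.

Lemma mulaa : a * a = 1.
Proof. by rewrite -(expg_order a) a2. Qed.

Lemma involution_neq1 : a == 1 = false.
Proof. by rewrite -order_eq1 a2. Qed.

Lemma mulaaK x : x * a * a = x.
Proof. by rewrite -mulgA mulaa mulg1. Qed.

Lemma involution_inv : a^-1 = a.
Proof. by apply: (mulgI a); rewrite mulgV mulaa. Qed.

(** This is [(a * c) ^+ 3 = 1] solved for [a * c * a]; the prefix [x] lets it rewrite inside
    left-associated products. *)
Lemma aca x : x * a * c * a = x * c^-1 * a * c^-1.
Proof.
rewrite -!mulgA; congr (x * _); apply: (mulgI c); rewrite mulKVg.
apply: (mulgI a); apply: (mulIg c).
by rewrite !mulgA mulaa mulgKV -(expg_order (a * c)) ac3 !expgS mulg1 !mulgA.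
Qed.

Lemma aVca x : x * a * c^-1 * a = x * c * a * c.
Proof.
suff E : a * c^-1 * a = c * a * c by rewrite -!mulgA in E *; rewrite E.
apply: invg_inj; rewrite !invMg !invgK !involution_inv.
by rewrite -[RHS]mul1g !mulgA -aca mul1g.
Qed.

(** Inserting [a * a] between the two inverses leaves two instances of [aVca]; the result is
    [x * c * u * c]. *)
Lemma aVc2a x : x * a * c^-1 * c^-1 * a = x * c * a * c * c * a * c.
Proof. by rewrite -[x * a * c^-1]mulaaK 2!aVca. Qed.

Lemma mem_double_coset g x y : x \in C -> y \in C -> x * g * y \in D g.
Proof. by move=> Cx Cy; rewrite mem_mulg // mem_rcoset mulgK. Qed.

Lemma double_cosetP g z :
  reflect (exists x k, [/\ x \in C, k < n & z = x * g * c ^+ k]) (z \in D g).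
Proof.
apply: (iffP mulsgP) => [[_ y /rcosetP[x Cx ->] /cyclePmin[k lt_k ->] ->]|].
  by exists x, k; rewrite -cn.
by case=> x [k [Cx _ ->]]; exists (x * g) (c ^+ k);
  rewrite ?mem_cycle // mem_rcoset mulgK.
Qed.

Lemma card_double_coset g : #|D g| <= n * n.
Proof.
rewrite (leq_trans (card_mulg_leq _ _)) // card_rcoset.
by rewrite -[#|C|]/#[c] cn.
Qed.

Let Cc : c \in C := cycle_id c.
Let CV : c^-1 \in C := groupVr Cc.
Let CM := @groupM _ <[c]>.

Lemma mem_double_coset1 g x : x \in C -> x * g \in D g.
Proof. by move=> Cx; rewrite -[x * g]mulg1 mem_double_coset. Qed.

(** The set [C :|: D a] is stable because [a * c ^+ k * a] collapses by [aca] for k = 1 and, when n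
    = 3, by [aVca] for k = 2. *)
Lemma card_triangle23_leq : n = 2 \/ n = 3 -> #|<<[set a; c]>>| <= n + n * n.
Proof.
move=> n23; pose X : {set gT} := C :|: D a.
apply: leq_trans (_ : #|X| <= _); last first.
  rewrite (leq_trans (leq_card_setU _ _)) //.
  by rewrite leq_add ?card_double_coset // -cn.
apply/subset_leq_card/gen_sub_closed=> [|z s Xz]; first by rewrite inE group1.
have [Cz|/double_cosetP[x [k [Cx k_lt ->]]]] := setUP Xz; case/set2P=> ->.
- by rewrite inE mem_double_coset1 ?orbT.
- by rewrite inE CM.
- case: k k_lt => [|[|[|k]]] k_lt.
  + by rewrite mulg1 mulaaK inE Cx.
  + by rewrite aca !inE mem_double_coset ?orbT ?CM.
  + case: n23 => n3; first by rewrite n3 in k_lt.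
    have -> : c ^+ 2 = c^-1.
      by apply: (mulgI c); rewrite mulgV -expgS -[3]n3 -cn expg_order.
    by rewrite aVca !inE mem_double_coset ?orbT ?CM.
  + by case: n23 k_lt => ->.
- by rewrite -mulgA -expgSr !inE mem_double_coset ?mem_cycle ?orbT.
Qed.

(** For n = 4, [c ^+ 2] is its own inverse, so [aVc2a] reads [u = c * u * c]. Thus [u] inverts [c],
    and [D u] shrinks to the single coset [C :* u]. *)
Lemma u_conj : n = 4 -> u * c = c^-1 * u.
Proof.
move=> n4; apply: (mulgI c); rewrite mulKVg.
suff cc x : x * c * c = x * c^-1 * c^-1.
  by rewrite !mulgA /u -[c * a]mul1g !mulgA -aVc2a -cc mul1g.
by apply: (mulIg (c * c)); rewrite !mulgA !mulgKV -!mulgA -[RHS]mulg1;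
   congr (x * _); rewrite -(expg_order c) cn n4.
Qed.

Lemma card_triangle4_leq : n = 4 -> #|<<[set a; c]>>| <= 24.
Proof.
move=> n4; pose X : {set gT} := C :|: D a :|: C :* u.
apply: leq_trans (_ : #|X| <= _); last first.
  have CDa := leq_trans (leq_card_setU C (D a))
    (leq_add (leqnn _) (card_double_coset a)).
  apply: leq_trans (leq_card_setU _ _) _; rewrite card_rcoset.
  by apply: leq_trans (leq_add CDa (leqnn _)) _; rewrite -[#|C|]/#[c] cn n4.
have c3 : c ^+ 3 = c^-1.
  by apply: (mulgI c); rewrite mulgV -expgS -[4]n4 -cn expg_order.
apply/subset_leq_card/gen_sub_closed=> [|z s Xz]; first by rewrite !inE group1.
case/setUP: Xz =>
  [/setUP[Cz|/double_cosetP[x [k [Cx k_lt ->]]]]|/rcosetP[x Cx ->]];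
  case/set2P=> ->.
- by rewrite !inE mem_double_coset1 ?orbT.
- by rewrite !inE CM.
- rewrite n4 in k_lt; case: k k_lt => [|[|[|[|]]]] // _.
  + by rewrite mulg1 mulaaK !inE Cx.
  + by rewrite aca !inE mem_double_coset ?orbT ?CM.
  + have -> : x * a * c ^+ 2 * a = x * u by rewrite /u !mulgA.
    by rewrite !inE mem_rcoset mulgK Cx !orbT.
  + by rewrite c3 aVca !inE mem_double_coset ?orbT ?CM.
- by rewrite -mulgA -expgSr !inE mem_double_coset ?mem_cycle ?orbT.
- by rewrite /u !mulgA mulaaK -mulgA !inE mem_double_coset ?orbT ?CM.
- by rewrite -mulgA u_conj // mulgA !inE mem_rcoset mulgK (CM Cx CV) orbT.
Qed.

Lemma c3V2 x : n = 5 -> x * c * c * c = x * c^-1 * c^-1.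
Proof.
move=> n5; apply: (mulIg (c * c)); rewrite !mulgA !mulgKV -!mulgA.
by rewrite -[RHS]mulg1; congr (x * _); rewrite -(expg_order c) cn n5.
Qed.

Lemma cV3_2 x : n = 5 -> x * c^-1 * c^-1 * c^-1 = x * c * c.
Proof. by move=> n5; rewrite -c3V2 // mulgKV. Qed.

(** Two uses of [aVc2a], each followed by [c3V2], turn [t] into [c * t * c]. Thus [t] inverts [c],
    and [D t] shrinks to [C :* t]. *)
Lemma t_conj : n = 5 -> t * c = c^-1 * t.
Proof.
move=> n5; apply: (mulgI c); rewrite mulKVg.
rewrite /t /u -[a * c]mul1g !mulgA mulg1.
by rewrite [in RHS]aVc2a c3V2 // [in RHS]aVc2a c3V2 // mul1g.
Qed.

Lemma ac2ac2a x : n = 5 ->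
  x * a * c * c * a * c * c * a = x * c^-1 * a * c * c * a * c^-1.
Proof.
move=> n5; rewrite -[x * a * c]mulaaK 2!aca.
by rewrite mulgKV -[_ * c * a]mulgA -[_ * (c * a)]mulgA !mulgA aca cV3_2.
Qed.

Lemma card_triangle5_leq : n = 5 -> #|<<[set a; c]>>| <= 60.
Proof.
move=> n5; pose X : {set gT} := C :|: D a :|: D u :|: C :* t.
apply: leq_trans (_ : #|X| <= _); last first.
  have CDa := leq_trans (leq_card_setU C (D a))
    (leq_add (leqnn _) (card_double_coset a)).
  have CDu := leq_trans (leq_card_setU _ (D u))
    (leq_add CDa (card_double_coset u)).
  apply: leq_trans (leq_card_setU _ _) _; rewrite card_rcoset.
  by apply: leq_trans (leq_add CDu (leqnn _)) _; rewrite -[#|C|]/#[c] cn n5.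
have c4 : c ^+ 4 = c^-1.
  by apply: (mulgI c); rewrite mulgV -expgS -[5]n5 -cn expg_order.
have c3 : c ^+ 3 = c^-1 * c^-1.
  by rewrite -[RHS]mul1g mulgA -c3V2 // !expgS mulg1 mul1g !mulgA.
apply/subset_leq_card/gen_sub_closed=> [|z s Xz]; first by rewrite !inE group1.
case/setUP: Xz => [/setUP[/setUP[Cz|]|]|/rcosetP[x Cx ->]].
- case/set2P=> ->; first by rewrite !inE mem_double_coset1 ?orbT.
  by rewrite !inE CM.
- case/double_cosetP=> x [k [Cx k_lt ->]]; case/set2P=> ->; last first.
    by rewrite -mulgA -expgSr !inE mem_double_coset ?mem_cycle ?orbT.
  rewrite n5 in k_lt; case: k k_lt => [|[|[|[|[|]]]]] // _.
  + by rewrite mulg1 mulaaK !inE Cx.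
  + by rewrite aca !inE mem_double_coset ?orbT ?CM.
  + have -> : x * a * c ^+ 2 * a = x * u by rewrite /u !mulgA.
    by rewrite !inE mem_double_coset1 ?orbT.
  + have -> : x * a * c ^+ 3 * a = x * c * u * c.
      by rewrite c3 !mulgA aVc2a ?mulgA.
    by rewrite !inE mem_double_coset ?orbT ?CM.
  + by rewrite c4 aVca !inE mem_double_coset ?orbT ?CM.
- case/double_cosetP=> x [k [Cx k_lt ->]]; case/set2P=> ->; last first.
    by rewrite -mulgA -expgSr !inE mem_double_coset ?mem_cycle ?orbT.
  (* For k = 0, ..., 4 the products [u * c ^+ k * a] land in [D a], [D a], [D u], [C :* t] and
     [D u]. *)
  rewrite n5 in k_lt; case: k k_lt => [|[|[|[|[|]]]]] // _.
  + rewrite mulg1 /u !mulgA mulaaK -mulgA.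
    by rewrite !inE mem_double_coset ?orbT ?CM.
  + have -> : x * u * c ^+ 1 * a = x * c^-1 * a * (c^-1 * c^-1).
      by rewrite expg1 /u !mulgA aca mulgK aca.
    by rewrite !inE mem_double_coset ?orbT ?CM.
  + have -> : x * u * c ^+ 2 * a = x * c^-1 * u * c^-1.
      by rewrite /u !mulgA ac2ac2a.
    by rewrite !inE mem_double_coset ?orbT ?CM.
  + have -> : x * u * c ^+ 3 * a = x * t by rewrite c3 /t !mulgA.
    by rewrite !inE mem_rcoset mulgK Cx ?orbT.
  + have -> : x * u * c ^+ 4 * a = x * c * u * (c * c).
      by rewrite c4 /u !mulgA aVca c3V2 // aVc2a.
    by rewrite !inE mem_double_coset ?orbT ?CM.
- case/set2P=> ->.
    have -> : x * t * a = x * u * (c^-1 * c^-1) by rewrite /t !mulgA mulaaK.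
    by rewrite !inE mem_double_coset ?orbT ?CM.
  by rewrite -mulgA t_conj // mulgA !inE mem_rcoset mulgK (CM Cx CV) orbT.
Qed.

Let G := <<[set a; c]>>%G.

Let Ga : a \in G. Proof. by rewrite mem_gen // set21. Qed.
Let Gc : c \in G. Proof. by rewrite mem_gen // set22. Qed.

Lemma neq_expg2 : 2 < n -> c * c != 1.
Proof.
move=> n_gt2; apply/eqP=> cc; have := order_dvdn c 2.
by rewrite cn expgS expg1 cc eqxx; apply/negP; rewrite gtnNdvd.
Qed.

(** As [x] normalises [B] and meets it trivially, [<[x]>] and [B] span a subgroup of order
    [2 * #|B|], and Lagrange applies. *)
Lemma dvd_card_involution x (B : {group gT}) :
    x \in G -> B \subset G -> #[x] = 2 -> x \in 'N(B) -> x \notin B ->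
  2 * #|B| %| #|G|.
Proof.
move=> Gx sBG x2 nBx B'x; have xB : <[x]> :&: B = 1.
  by rewrite prime_TIg -?orderE ?x2 // cycle_subG.
rewrite -{1}x2 -TI_cardMg // -norm_joinEl ?cycle_subG // cardSg //.
by rewrite join_subG cycle_subG Gx.
Qed.

Lemma dvd4_card_klein v :
  v \in G -> v * v = 1 -> v * a = a * v -> v != 1 -> v != a -> 4 %| #|G|.
Proof.
move=> Gv vv va v1 v'a; rewrite -[4]/(2 * 2)%N -{2}a2.
apply: (@dvd_card_involution v <[a]>) => //; first by rewrite cycle_subG.
- by apply: nt_prime_order => //; rewrite expgS expg1.
- by rewrite (subsetP (cent_sub _)) // cent_cycle; apply/cent1P.
apply/negP=> /cyclePmin[k]; rewrite a2; case: k => [|[|]] // _ v_def.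
  by rewrite v_def eqxx in v1.
by rewrite v_def eqxx in v'a.
Qed.

Lemma dvd_orders : (2 %| #|G|) && (3 %| #|G|) && (n %| #|G|).
Proof. by rewrite -{1}a2 -ac3 -cn !order_dvdG // groupM. Qed.

(* Involutions commuting with a (for n = 3, 5) or inverting c (for n = 4)
   supply the factors of the order that 2, 3 and n do not account for. *)
Lemma dvd12_card_triangle : n = 3 -> 12 %| #|G|.
Proof.
move=> n3; have ccV : c * c = c^-1.
  apply: (mulgI c); rewrite mulgV -(expg_order c) cn n3.
  by rewrite !expgS mulg1.
have VV x : x * c^-1 * c^-1 = x * c.
  by apply: (mulIg c); rewrite mulgKV -[RHS]mulgA ccV.
have /andP[/andP[_ d3] _] := dvd_orders.
rewrite (@Gauss_dvd 4 3) // d3 andbT; apply: (@dvd4_card_klein (c * a * c^-1)).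
- by rewrite !groupM ?groupV.
- by rewrite !mulgA mulgKV mulaaK mulgV.
- by rewrite aVca !mulgA -[a * c]mul1g mulgA aca VV mul1g ccV.
- by rewrite -[c in c * a]invgK -mulgA -conjgE conjg_eq1 involution_neq1.
(* If the conjugate of [a] were [a], then [a] and [c] would commute and [(a * c) ^+ 3 = 1] would
   give [a ^+ 3 = 1], against order 2. *)
apply/eqP=> aJc; have ca : commute a c by rewrite /commute -{1}aJc mulgKV.
have := expg_order (a * c); rewrite ac3 expgMn // -{2}n3 -cn expg_order mulg1.
by move/eqP; rewrite -order_dvdn a2.
Qed.

Lemma dvd24_card_triangle : n = 4 -> 24 %| #|G|.
Proof.
move=> n4; have /andP[/andP[_ d3] _] := dvd_orders.
rewrite (@Gauss_dvd 8 3) // d3 andbT -[8]/(2 * 4)%N -n4 -cn.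
have uE : u = (c ^+ 2) ^ a.
  by rewrite conjgE involution_inv expgS expg1 /u !mulgA.
apply: (@dvd_card_involution u <[c]>).
- by rewrite !groupM.
- by rewrite cycle_subG.
- by rewrite uE orderJ orderXdiv cn n4.
- rewrite -groupV inE -cycleJ cycle_subG conjgE invgK mulgA u_conj // mulgK.
  exact: CV.
(* Inside [<[c]>], [u] would both commute with [c] and invert it, forcing [c * c = 1]. *)
apply/negP=> Cu; have /eqP[] : c * c != 1 by rewrite neq_expg2 ?n4.
have cu : u * c = c * u.
  by apply: (centsP (cycle_abelian c)) => //; apply: cycle_id.
by apply: (mulIg u); rewrite -mulgA -cu u_conj // mulKVg mul1g.
Qed.

Lemma dvd60_card_triangle : n = 5 -> 60 %| #|G|.
Proof.
move=> n5; have /andP[/andP[_ d3]] := dvd_orders; rewrite n5 => d5.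
rewrite (@Gauss_dvd 12 5) // d5 andbT (@Gauss_dvd 4 3) // d3 andbT.
have cc1 : c * c != 1 by rewrite neq_expg2 ?n5.
have tE : t = a ^ (c^-1 * c^-1 * a).
  by rewrite conjgE !invMg !invgK involution_inv /t /u !mulgA.
have tt : t * t = 1 by rewrite tE -conjMg mulaa conj1g.
have tV : t * c^-1 = c * t.
  by apply: (mulIg c); rewrite mulgKV -mulgA t_conj // mulKVg.
(* The involution [t] inverts [c], so every product of a power of [c] with [t] squares to 1; this
   one also commutes with [a]. *)
apply: (@dvd4_card_klein (c^-1 * c^-1 * t)).
- by rewrite !groupM ?groupV.
- move: (t) tt tV => s ss sV; rewrite !mulgA -[_ * s * c^-1]mulgA sV.
  by rewrite mulgA mulgKV -[_ * s * c^-1]mulgA sV mulgA mulVg mul1g.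
- have -> : a * (c^-1 * c^-1 * t) = c * (t * c^-1 * c^-1) * a.
    by rewrite -[LHS]mul1g /t /u !mulgA (aVc2a 1) c3V2 // mul1g.
  move: (t) tV => s sV; rewrite sV -[c * s * _]mulgA sV !mulgA.
  by rewrite -[c * c]mul1g mulgA c3V2 // mul1g.
- apply/eqP=> t_eq; have := t_conj n5.
  have -> : t = c * c.
    by apply: (mulgI (c^-1 * c^-1)); rewrite t_eq mulgA !mulgKV mulVg.
  by rewrite mulKg -[RHS]mul1g => /mulIg/eqP; apply/negP.
(* Here [t = c * c * a], and [t_conj] yields [c * a * c = a], so that [(a * c) ^+ 2 = 1], against
   order 3. *)
apply/eqP=> t_eq; have := t_conj n5.
have -> : t = c * c * a.
  by apply: (mulgI (c^-1 * c^-1)); rewrite t_eq !mulgA mulgKV mulVg mul1g.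
rewrite !mulgA mulVg mul1g -!mulgA => /mulgI cac.
have := order_dvdn (a * c) 2; rewrite ac3 expgS expg1 -!mulgA cac mulaa eqxx.
by [].
Qed.

(** The coset covers bound the order from above, divisibility from below; the values are 6, 12, 24,
    60. *)
Lemma card_triangle : 1 < n < 6 -> #|G| = 12 * n %/ (6 - n).
Proof.
case/andP=> n_gt1 n_lt6; apply/eqP; rewrite eqn_leq.
have G_ge m : m %| #|G| -> m <= #|G| by apply: dvdn_leq.
have /andP[/andP[d2 d3] _] := dvd_orders.
have [n2|n3|n4|n5] : [\/ n = 2, n = 3, n = 4 | n = 5].
- by case: (n) n_gt1 n_lt6 => [|[|[|[|[|[|]]]]]] // _ _;
    [constructor 1 | constructor 2 | constructor 3 | constructor 4].
- have := card_triangle23_leq (or_introl n2); rewrite n2 => -> /=.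
  by apply: G_ge; rewrite (@Gauss_dvd 2 3) // d2.
- have := card_triangle23_leq (or_intror n3); rewrite n3 => -> /=.
  exact/G_ge/dvd12_card_triangle.
- by rewrite n4 card_triangle4_leq //; apply/G_ge/dvd24_card_triangle.
by rewrite n5 card_triangle5_leq //; apply/G_ge/dvd60_card_triangle.
Qed.

End Relations.

(** Pairing elements of equal order keeps that order, so [card_triangle] applies to pairs of
    generators. *)
Lemma order_pair_lcm (gT rT : finGroupType) (x : gT) (y : rT) :
  #[(x, y)] = lcmn #[x] #[y].
Proof.
have pairX k : (x, y) ^+ k = (x ^+ k, y ^+ k).
  by elim: k => // k IHk; rewrite !expgS IHk.
have pair1 k : (#[(x, y)] %| k) = (#[x] %| k) && (#[y] %| k).
  by rewrite !order_dvdn pairX.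
by apply/eqP; rewrite eqn_dvd pair1 dvdn_lcml dvdn_lcmr dvdn_lcm -pair1 dvdnn.
Qed.

Lemma triangle_isog (gT rT : finGroupType) (a c : gT) (a' c' : rT) n :
    1 < n < 6 -> #[a] = 2 -> #[c] = n -> #[a * c] = 3 ->
    #[a'] = 2 -> #[c'] = n -> #[a' * c'] = 3 ->
  <<[set a; c]>> \isog <<[set a'; c']>>.
Proof.
move=> n_lim a2 cn ac3 a'2 c'n ac'3.
pose H := <<[set (a, a'); (c, c')]>>%G.
have cardH : #|H| = 12 * n %/ (6 - n).
  apply: card_triangle => //;
    by rewrite order_pair_lcm ?a2 ?cn ?ac3 ?a'2 ?c'n ?ac'3
    /lcmn ?gcdnn ?mulnK // -cn.
have isogH (sT : finGroupType) (f : {morphism [set: gT * rT] >-> sT}) :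
    let x := f (a, a') in let y := f (c, c') in
    #[x] = 2 -> #[y] = n -> #[x * y] = 3 -> <<[set x; y]>> \isog H.
  move=> x y x2 yn xy3; have fH : f @* H = <<[set x; y]>>.
    by rewrite morphim_gen ?subsetT // morphimU !morphim_set1 ?inE.
  rewrite isogEcard cardH (card_triangle x2 yn xy3) // leqnn andbT /= -fH.
  by rewrite morphim_homg ?subsetT.
rewrite (isog_trans (isogH _ (fst_morphism gT rT) a2 cn ac3)) // isog_sym.
exact: (isogH _ (snd_morphism gT rT) a'2 c'n ac'3).
Qed.

End Triangle.

(** * Permutation models of the triangle groups *)

Section Permutations.
Local Open Scope nat_scope.
Local Open Scope group_scope.

(** Stands in for [nt_prime_order] at the one composite order that occurs. *)
Lemma order_eq4 (gT : finGroupType) (x : gT) :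
  x ^+ 4 = 1 -> x ^+ 2 != 1 -> #[x] = 4.
Proof.
move=> x4 x2; have d4 : #[x] %| 4 by rewrite order_dvdn x4.
have d2 : ~~ (#[x] %| 2) by rewrite order_dvdn.
have := @dvdn_leq _ 4 isT d4; case: #[x] d4 d2 => [|[|[|[|[|]]]]] //.
Qed.

(** By cardinality, it is enough that [a'] and [c'] lie in [K]; that they generate it follows. *)
Lemma triangle_isog_of_card (gT rT : finGroupType) (a c : gT) (a' c' : rT)
    (K : {group rT}) n :
    1 < n < 6 -> #[a] = 2 -> #[c] = n -> #[a * c] = 3 ->
    #[a'] = 2 -> #[c'] = n -> #[a' * c'] = 3 ->
    a' \in K -> c' \in K -> #|K| = 12 * n %/ (6 - n) ->
  <<[set a; c]>> \isog K.
Proof.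
move=> n_lim a2 cn ac3 a'2 c'n ac'3 Ka Kc cardK.
have -> : K = <<[set a'; c']>>%G.
  apply/esym/eqP; rewrite -val_eqE eqEcard cardK.
  rewrite (card_triangle a'2 c'n ac'3) //.
  by rewrite leqnn gen_subG subUset !sub1set Ka Kc.
exact: (triangle_isog n_lim a2 cn ac3 a'2 c'n ac'3).
Qed.

Local Notation transp n i j := (tperm (@Ordinal n i isT) (@Ordinal n j isT)).

Ltac perm_simpl := by rewrite ?(expgS, expg0, mulg1, permM, permE) /=.
Ltac perm_eq :=
  apply/permP; case=> [[|[|[|[|[|i]]]]] // i_lt]; apply/val_inj; perm_simpl.
Ltac perm_neq :=
  apply/eqP=> /permP /(_ ord0) /(congr1 val); perm_simpl.
Ltac perm_order := apply: nt_prime_order; [by [] | perm_eq | perm_neq].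

Variables (gT : finGroupType) (a c : gT).

Lemma isog_Sym3 :
  #[a] = 2 -> #[c] = 2 -> #[a * c] = 3 -> <<[set a; c]>> \isog 'Sym_('I_3).
Proof.
move=> a2 c2 ac3; pose s := transp 3 0 1; pose r := transp 3 0 2.
apply: (@triangle_isog_of_card _ _ a c s r) a2 c2 ac3 _ _ _ _ _ _ => //.
1-3: perm_order.
1-2: by rewrite /= inE.
by rewrite /= card_Sym card_ord.
Qed.

Lemma isog_Alt4 :
  #[a] = 2 -> #[c] = 3 -> #[a * c] = 3 -> <<[set a; c]>> \isog 'Alt_('I_4).
Proof.
move=> a2 c3 ac3; pose s := transp 4 0 1 * transp 4 2 3.
pose r := transp 4 0 1 * transp 4 0 2.
apply: (@triangle_isog_of_card _ _ a c s r) a2 c3 ac3 _ _ _ _ _ _ => //.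
1-3: perm_order.
1-2: by rewrite /= Alt_even odd_permM !odd_tperm.
by apply/double_inj; rewrite -mul2n /= card_Alt card_ord.
Qed.

Lemma isog_Sym4 :
  #[a] = 2 -> #[c] = 4 -> #[a * c] = 3 -> <<[set a; c]>> \isog 'Sym_('I_4).
Proof.
move=> a2 c4 ac3; pose s := transp 4 0 1.
pose r := transp 4 0 1 * transp 4 0 2 * transp 4 0 3.
apply: (@triangle_isog_of_card _ _ a c s r) a2 c4 ac3 _ _ _ _ _ _ => //.
- perm_order.
- by apply: order_eq4; [perm_eq | perm_neq].
- perm_order.
1-2: by rewrite /= inE.
by rewrite /= card_Sym card_ord.
Qed.

Lemma isog_Alt5 :
  #[a] = 2 -> #[c] = 5 -> #[a * c] = 3 -> <<[set a; c]>> \isog 'Alt_('I_5).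
Proof.
move=> a2 c5 ac3; pose s := transp 5 0 1 * transp 5 2 3.
(* With this 3-cycle, [s * b] is the 5-cycle adding 1 modulo 5; taking it as [c'] makes [a' * c']
   equal to [b]. *)
pose b := transp 5 0 2 * transp 5 0 4.
have s2 : #[s] = 2 by perm_order.
have sr : s * (s * b) = b by rewrite mulgA (mulaa s2) mul1g.
have rE i : (s * b) i = ordS i.
  by case: i => [[|[|[|[|[|i]]]]] // i_lt]; apply/val_inj; perm_simpl.
apply: (@triangle_isog_of_card _ _ a c s (s * b)) a2 c5 ac3 s2 _ _ _ _ _ => //.
- move: (s * b) rE => r rE; apply: nt_prime_order => //.
    apply/permP=> i; rewrite !(expgS, expg0, mulg1) !permM !rE perm1.
    by case: i => [[|[|[|[|[|i]]]]] // i_lt]; apply/val_inj.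
  by apply/eqP=> /permP/(_ ord0); rewrite rE perm1.
- by rewrite sr; perm_order.
1-2: by rewrite /= Alt_even !odd_permM !odd_tperm.
by apply/double_inj; rewrite -mul2n /= card_Alt card_ord.
Qed.

End Permutations.

(** * The rotation matrices *)

Section Matrices.
Variable R : comNzRingType.
Implicit Types x y t : R.

(** This and the next three lemmas let [mx3_ring] split a matrix identity into nine ring
    identities. *)
Lemma mul_mx3 (a b c d e f g h k a' b' c' d' e' f' g' h' k' : R) :
  mx3 [:: [:: a; b; c]; [:: d; e; f]; [:: g; h; k]] *
    mx3 [:: [:: a'; b'; c']; [:: d'; e'; f']; [:: g'; h'; k']] =
  mx3 [:: [:: a * a' + b * d' + c * g';
              a * b' + b * e' + c * h';
              a * c' + b * f' + c * k'];
          [:: d * a' + e * d' + f * g';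
              d * b' + e * e' + f * h';
              d * c' + e * f' + f * k'];
          [:: g * a' + h * d' + k * g';
              g * b' + h * e' + k * h';
              g * c' + h * f' + k * k']].
Proof.
apply/matrixP=> i j; rewrite !mxE !big_ord_recl big_ord0 !mxE /= addr0 addrA.
by case: i j => [[|[|[|i]]] ?] [[|[|[|j]]] ?].
Qed.

Lemma add_mx3 (a b c d e f g h k a' b' c' d' e' f' g' h' k' : R) :
  mx3 [:: [:: a; b; c]; [:: d; e; f]; [:: g; h; k]] +
    mx3 [:: [:: a'; b'; c']; [:: d'; e'; f']; [:: g'; h'; k']] =
  mx3 [:: [:: a + a'; b + b'; c + c'];
          [:: d + d'; e + e'; f + f'];
          [:: g + g'; h + h'; k + k']].
Proof.
apply/matrixP=> i j; rewrite !mxE.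
by case: i j => [[|[|[|i]]] ?] [[|[|[|j]]] ?].
Qed.

Lemma opp_mx3 (a b c d e f g h k : R) :
  - mx3 [:: [:: a; b; c]; [:: d; e; f]; [:: g; h; k]] =
  mx3 [:: [:: - a; - b; - c]; [:: - d; - e; - f]; [:: - g; - h; - k]].
Proof.
apply/matrixP=> i j; rewrite !mxE.
by case: i j => [[|[|[|i]]] ?] [[|[|[|j]]] ?].
Qed.

Lemma scalar_mx3 (a : R) :
  a%:M = mx3 [:: [:: a; 0; 0]; [:: 0; a; 0]; [:: 0; 0; a]].
Proof.
apply/matrixP=> i j; rewrite !mxE.
by case: i j => [[|[|[|i]]] ?] [[|[|[|j]]] ?].
Qed.

Ltac mx3_ring :=
  rewrite !(expr2, scalar_mx3, mul_mx3, opp_mx3, add_mx3);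
  do ![congr (_ :: _) | congr mx3]; ring.

Lemma rho_vef x y : rho_v x y * rho_e x y * rho_f x y = 1.
Proof. by rewrite -[1]/(1%:M); mx3_ring. Qed.

Lemma rho_e_sqr x y : rho_e x y ^+ 2 = 1.
Proof. by rewrite -[1]/(1%:M); mx3_ring. Qed.

(* The rotations have determinant 1 and the eigenvalue 1, so this is their
   characteristic polynomial; t stands for twice the cosine of the angle. *)
Definition rotation_poly t : {poly R} := ('X - 1) * ('X^2 - t%:P * 'X + 1).

(** Zero is spelled [0%:M] in the premise so that [mx3_ring] can expand it by [scalar_mx3]. *)
Lemma rotation_mx (M : 'M[R]_3) t :
  (M - 1%:M) * (M ^+ 2 - t%:M * M + 1%:M) = 0%:M ->
  horner_mx M (rotation_poly t) = 0.
Proof.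
rewrite raddf0 => <-.
rewrite /rotation_poly !(rmorphM, rmorphB, rmorphD, rmorphXn, rmorph1) /=.
by rewrite horner_mx_X horner_mx_C.
Qed.

(** The parameter is the trace minus the eigenvalue 1. *)
Lemma rho_v_rotation x y :
  horner_mx (rho_v x y) (rotation_poly ((1 + x) * (1 - y) - 2)) = 0.
Proof.
by apply: rotation_mx; mx3_ring.
Qed.

Lemma rho_f_rotation x y : horner_mx (rho_f x y) (rotation_poly (- 2 * x)) = 0.
Proof.
by apply: rotation_mx; mx3_ring.
Qed.

Lemma rotation_expr (M : 'M[R]_3) t q n :
  horner_mx M (rotation_poly t) = 0 -> 'X^n - 1 = rotation_poly t * q ->
  M ^+ n = 1.
Proof.
move=> Mt /(congr1 (horner_mx M)); rewrite rmorphB rmorphM rmorphXn rmorph1 /=.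
by rewrite Mt mul0r horner_mx_X => /subr0_eq.
Qed.

Lemma rotation_expr3 (M : 'M[R]_3) t :
  horner_mx M (rotation_poly t) = 0 -> t = -1 -> M ^+ 3 = 1.
Proof.
move=> Mt t1; apply: (rotation_expr (q := 1) Mt).
by rewrite t1 /rotation_poly rmorphN1; ring.
Qed.

Lemma rotation_expr4 (M : 'M[R]_3) t :
  horner_mx M (rotation_poly t) = 0 -> t = 0 -> M ^+ 4 = 1.
Proof.
move=> Mt t0; apply: (rotation_expr (q := 'X + 1) Mt).
by rewrite t0 /rotation_poly rmorph0; ring.
Qed.

(** When [t ^+ 2 + t = 1], the fifth cyclotomic polynomial splits into two quadratic factors, one
    for [t] and one for the other root [- 1 - t]. *)
Lemma rotation_expr5 (M : 'M[R]_3) t :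
  horner_mx M (rotation_poly t) = 0 -> t ^+ 2 + t = 1 -> M ^+ 5 = 1.
Proof.
move=> Mt /(congr1 polyC); rewrite rmorphD rmorphXn rmorph1 /= => t1.
apply: (rotation_expr (q := 'X^2 + (1 + t%:P) * 'X + 1) Mt).
have {}t1 : t%:P ^+ 2 = 1 - t%:P by rewrite -t1 addrK.
by rewrite /rotation_poly; ring: t1.
Qed.

End Matrices.

(** * Dropping one of three generators with product 1 *)

Section ProductOne.
Variables (gT : finGroupType) (v e f : gT).
Hypothesis vef : (v * e * f = 1)%g.

Lemma order_mul_ef : #[e * f]%g = #[v]%g.
Proof.
by rewrite -[RHS]orderV; congr #[_]%g; apply/(mulgI v); rewrite mulgA vef mulgV.
Qed.

(** The product [e * v] is conjugate to [v * e], the inverse of [f]. *)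
Lemma order_mul_ev : #[e * v]%g = #[f]%g.
Proof.
have -> : (e * v = (v * e) ^ v)%g by rewrite conjgE !mulgA mulVg mul1g.
rewrite orderJ -[RHS]orderV; congr #[_]%g.
by apply/(mulIg f); rewrite vef mulVg.
Qed.

Lemma gen_ef : <<[set v; e; f]>>%g = <<[set e; f]>>%g.
Proof.
have v_gen : v \in <<[set e; f]>>%g.
  have -> : v = ((e * f)^-1)%g by apply: (mulIg (e * f)%g); rewrite mulVg mulgA.
  by rewrite groupV groupM // mem_gen ?set21 ?set22.
apply/eqP; rewrite eqEsubset !gen_subG !subUset !sub1set v_gen.
by rewrite !mem_gen // !inE eqxx ?orbT.
Qed.

Lemma gen_ev : <<[set v; e; f]>>%g = <<[set e; v]>>%g.
Proof.
have f_gen : f \in <<[set e; v]>>%g.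
  have -> : f = ((v * e)^-1)%g by apply: (mulgI (v * e)%g); rewrite mulgV.
  by rewrite groupV groupM // mem_gen ?set21 ?set22.
apply/eqP; rewrite eqEsubset !gen_subG !subUset !sub1set f_gen.
by rewrite !mem_gen // !inE eqxx ?orbT.
Qed.

End ProductOne.

(** * Orders of the rotations in the linear group *)

Section Generators.
Variables (F : finFieldType) (x y : F).
Local Notation ord1 := (@Ordinal 3 1 isT).

Let v := FinRing.Unit (rho_v_unit x y).
Let e := FinRing.Unit (rho_e_unit x y).
Let f := FinRing.Unit (rho_f_unit x y).

Lemma GL_expr_eq1 (g : {unit 'M[F]_3}) n : (g ^+ n == 1)%g = (val g ^+ n == 1).
Proof. by rewrite -val_eqE FinRing.val_unitX. Qed.

Lemma GL_prime_order (g : {unit 'M[F]_3}) q :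
  prime q -> val g ^+ q = 1 -> val g != 1 -> #[g]%g = q.
Proof.
move=> q_pr gq g1; apply: nt_prime_order => //.
by apply/eqP; rewrite GL_expr_eq1 gq.
Qed.

Lemma GL_vef : (v * e * f = 1)%g.
Proof. by apply: val_inj; rewrite /= rho_vef. Qed.

(** If the matrix were 1, both 2 and [1 - y] would vanish in its second row. The disjunction admits
    the cube in characteristic 2, where [y = 0]. *)
Lemma order_e : (2 != 0 :> F) || (y != 1) -> #[e]%g = 2.
Proof.
move=> y1; apply: GL_prime_order; rewrite // ?rho_e_sqr //.
apply: contraTneq y1 => /matrixP e1; rewrite negb_or !negbK.
have := e1 ord1 0; have := e1 ord1 (@Ordinal 3 2 isT).
by rewrite !mxE /= => /eqP; rewrite subr_eq0 eq_sym => -> ->; rewrite eqxx.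
Qed.

Lemma neq_opp1 : 2 != 0 :> F -> -1 != 1 :> F.
Proof. by move=> F2; rewrite eq_sym -subr_eq0 opprK. Qed.

Lemma rho_v_neq1 : (2 != 0 :> F) || (x != 1) -> rho_v x y != 1.
Proof.
move=> x1; apply: contraTneq x1 => /matrixP v1; rewrite negb_or !negbK.
have := v1 0 ord1; have := v1 ord1 ord1.
rewrite !mxE /= => /esym/eqP; rewrite -subr_eq0 opprK => ->.
by move/eqP; rewrite subr_eq0 eq_sym.
Qed.

Lemma rho_f_neq1 : (2 != 0 :> F) || (x != 1) -> rho_f x y != 1.
Proof.
move=> x1; apply: contraTneq x1 => /matrixP f1; rewrite negb_or !negbK.
have := f1 0 ord1; have := f1 0 0.
rewrite !mxE /= => /esym/eqP; rewrite -subr_eq0 opprK => ->.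
by rewrite addrC => /eqP; rewrite subr_eq0.
Qed.

Lemma order_v q :
    prime q -> (2 != 0 :> F) || (x != 1) -> rho_v x y ^+ q = 1 ->
  #[v]%g = q.
Proof. by move=> q_pr /rho_v_neq1 v1 vq; apply: GL_prime_order. Qed.

Lemma order_f q :
    prime q -> (2 != 0 :> F) || (x != 1) -> rho_f x y ^+ q = 1 ->
  #[f]%g = q.
Proof. by move=> q_pr /rho_f_neq1 v1 vq; apply: GL_prime_order. Qed.

(** For the solids with three faces at a vertex: [v] has order 3 and [f] plays the part of [c]. *)
Lemma aut_group_ef (rT : finGroupType) (K : {group rT}) :
  <<[set e; f]>>%g \isog K -> aut_group x y \isog K.
Proof. by rewrite -(gen_ef GL_vef). Qed.

(** For the octahedron and the icosahedron, whose faces are triangles: [f] has order 3 and [v] plays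
    the part of [c]. *)
Lemma aut_group_ev (rT : finGroupType) (K : {group rT}) :
  <<[set e; v]>>%g \isog K -> aut_group x y \isog K.
Proof. by rewrite -(gen_ev GL_vef). Qed.

End Generators.

(* The first two relations for the dodecahedron only imply 5 times the third. *)
Definition cos_relations (P : polyhedron) (R : comNzRingType) (x y : R) :=
  match P with
  | Tetrahedron => 2 * x = 1 /\ 3 * y = 1
  | Cube => x = 0 /\ y = 0
  | Octahedron => 2 * x = 1 /\ 3 * y = -1
  | Dodecahedron =>
    [/\ 4 * x ^+ 2 = 2 * x + 1, 5 * y = 4 * x - 1 & 5 * y ^+ 2 = 1]
  | Icosahedron => 2 * x = 1 /\ 9 * y ^+ 2 = 5
  end.

(** * Automorphism groups from the relations between the cosines *)

Section Isog.
Variables (F : finFieldType) (x y : F).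
Implicit Types c z : F.

Lemma mulr_eq1_neq0 c z : c * z = 1 -> c != 0.
Proof.
move=> /eqP cz; apply/eqP=> c0.
by rewrite c0 mul0r eq_sym oner_eq0 in cz.
Qed.

Lemma mulr_eq1 c z : c * z = 1 -> z = c^-1.
Proof.
move=> cz; apply: (mulfI (mulr_eq1_neq0 cz)).
by rewrite cz mulfV ?(mulr_eq1_neq0 cz).
Qed.

(** The face rotation of the cube, of order 4 in other characteristics, here has order 2, so that n
    = 2. *)
Lemma isog_Cube2 : 2 = 0 :> F -> cos_relations Cube x y ->
  aut_group x y \isog 'Sym_('I_3).
Proof.
move=> F2 [x0 y0]; apply: aut_group_ef.
have x1 : (2 != 0 :> F) || (x != 1) by rewrite x0 [0 == 1]eq_sym oner_eq0 orbT.
have f2 : rho_f x y ^+ 2 = 1.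
  have N1 : -1 = 1 :> F by apply/eqP; rewrite eq_sym -subr_eq0 opprK; apply/eqP.
  (* This is the square at [x = 0] in any characteristic; modulo 2 it is the identity. *)
  transitivity (mx3 [:: [:: -1; 0; 0]; [:: 0; -1; 0]; [:: 2; 2; 1 : F]]).
    by rewrite expr2 mul_mx3 x0; do ![congr (_ :: _) | congr mx3]; ring.
  by rewrite N1 F2 -[RHS]/(1%:M) scalar_mx3.
apply: isog_Sym3.
- by apply: order_e; rewrite y0 [0 == 1]eq_sym oner_eq0 orbT.
- exact: order_f.
apply: etrans (order_mul_ef (GL_vef x y)) _; apply: order_v => //.
by apply: rotation_expr3 (rho_v_rotation x y) _; rewrite x0 y0; ring.
Qed.

Lemma isog_Cube : 2 != 0 :> F -> cos_relations Cube x y ->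
  aut_group x y \isog 'Sym_('I_4).
Proof.
move=> F2 [x0 y0]; apply: aut_group_ef.
apply: isog_Sym4.
- by apply: order_e; rewrite F2.
- apply: order_eq4; first apply/eqP; rewrite GL_expr_eq1.
    apply/eqP; apply: rotation_expr4 (rho_f_rotation x y) _.
    by rewrite x0 mulr0.
  (* The top left entry of the square is -1. *)
  apply: contra_neq (neq_opp1 F2) => /matrixP/(_ 0 0).
  by rewrite /= expr2 mul_mx3 !mxE /= x0 => f1; apply: etrans f1; ring.
apply: etrans (order_mul_ef (GL_vef x y)) _; apply: order_v; rewrite ?F2 //.
by apply: rotation_expr3 (rho_v_rotation x y) _; rewrite x0 y0; ring.
Qed.

Lemma isog_Tetrahedron : cos_relations Tetrahedron x y ->
  aut_group x y \isog 'Alt_('I_4).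
Proof.
move=> [x2 y3]; apply: aut_group_ef.
have F2 := mulr_eq1_neq0 x2; have F3 := mulr_eq1_neq0 y3.
apply: isog_Alt4.
- by apply: order_e; rewrite F2.
- apply: order_f; rewrite ?F2 //.
  by apply: rotation_expr3 (rho_f_rotation x y) _; rewrite mulNr x2.
apply: etrans (order_mul_ef (GL_vef x y)) _; apply: order_v; rewrite ?F2 //.
apply: rotation_expr3 (rho_v_rotation x y) _.
by rewrite (mulr_eq1 x2) (mulr_eq1 y3); field; rewrite F2 F3.
Qed.

Lemma isog_Octahedron : cos_relations Octahedron x y ->
  aut_group x y \isog 'Sym_('I_4).
Proof.
move=> [x2 y3]; apply: aut_group_ev.
have yN3 : 3 * - y = 1 by rewrite mulrN y3 opprK.
have F2 := mulr_eq1_neq0 x2; have F3 := mulr_eq1_neq0 yN3.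
have yE : y = - 3^-1 by rewrite -(mulr_eq1 yN3) opprK.
apply: isog_Sym4.
- by apply: order_e; rewrite F2.
- apply: order_eq4; first apply/eqP; rewrite GL_expr_eq1.
    apply/eqP; apply: rotation_expr4 (rho_v_rotation x y) _.
    by rewrite (mulr_eq1 x2) yE; field; rewrite F2 F3.
  (* The middle entry of the square is -1. *)
  apply: contra_neq (neq_opp1 F2).
  move=> /matrixP/(_ (@Ordinal 3 1 isT) (@Ordinal 3 1 isT)).
  rewrite /= expr2 mul_mx3 !mxE /= (mulr_eq1 x2) yE => v1.
  by apply: etrans v1; field; rewrite F2 F3.
apply: etrans (order_mul_ev (GL_vef x y)) _; apply: order_f; rewrite ?F2 //.
by apply: rotation_expr3 (rho_f_rotation x y) _; rewrite mulNr x2.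
Qed.

Lemma isog_Dodecahedron : 2 != 0 :> F -> cos_relations Dodecahedron x y ->
  aut_group x y \isog 'Alt_('I_5).
Proof.
move=> F2 [x2 y5 yy5]; apply: aut_group_ef.
have F5 := mulr_eq1_neq0 yy5.
apply: isog_Alt5.
- by apply: order_e; rewrite F2.
- apply: order_f; rewrite ?F2 //.
  apply: rotation_expr5 (rho_f_rotation x y) _.
  have -> : (- 2 * x) ^+ 2 = 4 * x ^+ 2 by ring.
  by rewrite x2; ring.
apply: etrans (order_mul_ef (GL_vef x y)) _; apply: order_v; rewrite ?F2 //.
apply: rotation_expr3 (rho_v_rotation x y) _.
(* Multiplying by 5, nonzero by the third relation, makes [5 * y] appear, which the second relation
   expresses through [x]. *)
apply: (mulfI F5).
have -> : 5 * ((1 + x) * (1 - y) - 2) = (1 + x) * (5 - 5 * y) - 10 by ring.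
have -> : (1 + x) * (5 - 5 * y) - 10 = 2 * x - 4 - 4 * x ^+ 2.
  by rewrite y5; ring.
by rewrite x2; ring.
Qed.

Lemma isog_Icosahedron : cos_relations Icosahedron x y ->
  aut_group x y \isog 'Alt_('I_5).
Proof.
move=> [x2 yy]; apply: aut_group_ev.
have F2 := mulr_eq1_neq0 x2.
apply: isog_Alt5.
- by apply: order_e; rewrite F2.
- apply: order_v; rewrite ?F2 //.
  apply: rotation_expr5 (rho_v_rotation x y) _.
  set t := _ - 2; have t2 : 2 * t = - 1 - 3 * y.
    have -> : 2 * t = (2 + 2 * x) * (1 - y) - 4 by rewrite /t; ring.
    by rewrite x2; ring.
  (* Completing the square: 4 times the left side is [(2 * t + 1) ^+ 2 - 1], where
     [2 * t + 1 = - 3 * y]. *)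
  apply: (mulfI (mulf_neq0 F2 F2)).
  have -> : 2 * 2 * (t ^+ 2 + t) = (2 * t) ^+ 2 + 2 * (2 * t) by ring.
  have -> : (2 * t) ^+ 2 + 2 * (2 * t) = 9 * y ^+ 2 - 1 by rewrite t2; ring.
  by rewrite yy; ring.
apply: etrans (order_mul_ev (GL_vef x y)) _; apply: order_f; rewrite ?F2 //.
by apply: rotation_expr3 (rho_f_rotation x y) _; rewrite mulNr x2.
Qed.

(** The relation itself exhibits an inverse of 2. *)
Lemma dodecahedron_char_neq2 : 4 * x ^+ 2 = 2 * x + 1 -> 2 != 0 :> F.
Proof.
move=> x2; apply: (@mulr_eq1_neq0 _ (2 * x ^+ 2 - x)).
have -> : 2 * (2 * x ^+ 2 - x) = 4 * x ^+ 2 - 2 * x by ring.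
by rewrite x2; ring.
Qed.

(** Doubling the relation for [y] and using 2 * 5 - 9 = 1 gives an inverse of 3. *)
Lemma icosahedron_char_neq3 : 2 * x = 1 -> 9 * y ^+ 2 = 5 -> 3 != 0 :> F.
Proof.
move=> x2 yy; apply: (@mulr_eq1_neq0 _ (y ^+ 2 * 6 - 3)).
have -> : 3 * (y ^+ 2 * 6 - 3) = 2 * (9 * y ^+ 2) - 9 by ring.
by rewrite yy; ring.
Qed.

End Isog.

(** * Reductions *)

Lemma cos_relations_algC P : cos_relations P (cos_face P) (cos_dihedral P).
Proof.
have s5 : sqrtC 5 ^+ 2 = 5 :> algC by rewrite sqrtCK.
by case: P => /=; split; try field: s5.
Qed.

Ltac rmorph_simpl :=
  rewrite ?(rmorphD, rmorphN, rmorphM, rmorphXn, rmorph0, rmorph1,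
    rmorph_nat) /=.

Lemma cos_relations_morph P (A R : comNzRingType) (f : {rmorphism A -> R}) a b :
  cos_relations P a b -> cos_relations P (f a) (f b).
Proof.
case: P => /= -[/(congr1 f) h1 /(congr1 f) h2] => [|||/(congr1 f) h3|];
  by split; [move: h1 | move: h2 | move: h3 ..]; rmorph_simpl.
Qed.

Lemma cos_relations_inj P (A R : comNzRingType) (f : {rmorphism A -> R}) a b :
  injective f -> cos_relations P (f a) (f b) -> cos_relations P a b.
Proof.
by move=> f_inj; case: P => /= -[h1 h2] => [|||h3|];
   split; apply: f_inj; rmorph_simpl.
Qed.

(** Having integer coefficients, the relations descend from [algC] to [A] by injectivity of [iota],
    then pass to [F] along [f]. *)
Lemma cos_relations_reduction P (F : fieldType) (x y : F) :
  polyhedron_reduction P x y -> cos_relations P x y.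
Proof.
move=> [A [iota [f [a [b [iota_inj aE bE <- <-]]]]]].
apply/cos_relations_morph/(cos_relations_inj iota_inj).
by rewrite aE bE; apply: cos_relations_algC.
Qed.

(* R[sqrt d], the pair (u, v) standing for u + v * sqrt d. *)
Definition quad (R : nzRingType) (d : R) : Type := (R * R)%type.

(** * Ring structure and evaluation for adjoined square roots *)

Section Quad.
Variables (R : comNzRingType) (d : R).

HB.instance Definition _ := GRing.Zmodule.on (quad d).

Implicit Types z w : quad d.
Definition quad_one : quad d := (1, 0).
Definition quad_mul z w : quad d :=
  (z.1 * w.1 + d * z.2 * w.2, z.1 * w.2 + z.2 * w.1).

Fact quad_mulA : associative quad_mul.
Proof. by move=> z w t; congr pair => /=; ring. Qed.
Fact quad_mulC : commutative quad_mul.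
Proof. by move=> z w; congr pair => /=; ring. Qed.
Fact quad_mul1 : left_id quad_one quad_mul.
Proof. by case=> z1 z2; congr pair => /=; ring. Qed.
Fact quad_mulDl : left_distributive quad_mul +%R.
Proof. by move=> z w t; congr pair => /=; ring. Qed.
Fact quad_one_neq0 : quad_one != 0.
Proof. by rewrite xpair_eqE oner_eq0. Qed.

HB.instance Definition _ := GRing.Zmodule_isComNzRing.Build (quad d)
  quad_mulA quad_mulC quad_mul1 quad_mulDl quad_one_neq0.

Variables (S : comNzRingType) (g : {rmorphism R -> S}) (s : S).
Hypothesis s_sqr : s ^+ 2 = g d.

(* The hypothesis is an argument so that the morphism structure of quad_eval
   can be inferred from the term alone. *)
Definition quad_eval of s ^+ 2 = g d := fun z : quad d => g z.1 + g z.2 * s.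

Fact quad_eval_zmod : zmod_morphism (quad_eval s_sqr).
Proof. by move=> z w; rewrite /quad_eval !rmorphB; ring. Qed.
Fact quad_eval_monoid : monoid_morphism (quad_eval s_sqr).
Proof.
split=> [|z w]; first by rewrite /quad_eval rmorph1 rmorph0; ring.
by rewrite /quad_eval !rmorphD !rmorphM /= -s_sqr; ring.
Qed.

HB.instance Definition _ :=
  GRing.isZmodMorphism.Build _ _ (quad_eval s_sqr) quad_eval_zmod.
HB.instance Definition _ :=
  GRing.isMonoidMorphism.Build _ _ (quad_eval s_sqr) quad_eval_monoid.

End Quad.

(** * Localization of the integers at p and its residue morphism *)

Section Localization.
Variable p : nat.

Definition p_integral : {pred rat} := [pred r | coprime p `|denq r|].

Lemma numq_cross (r : rat) (d n : int) :
  r * d%:~R = n%:~R -> numq r * d = n * denq r.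
Proof.
move=> rd; apply/eqP; rewrite -(eqr_int rat) !rmorphM /= -rd numqE.
by apply/eqP; ring.
Qed.

(** Any denominator prime to [p] will do, reduced or not, so products of denominators witness the
    closure properties. *)
Lemma p_integralP r :
  reflect (exists2 d : int, coprime p `|d| & exists n : int, r * d%:~R = n%:~R)
          (r \in p_integral).
Proof.
apply: (iffP idP) => [pr | [d pd [n rd]]].
  exists (denq r) => //; exists (numq r).
  by rewrite -{1}[r]divq_num_den divfK ?intr_eq0 ?denq_neq0.
rewrite inE /=; apply: coprime_dvdr pd; rewrite -dvdzE.
(* The reduced denominator divides [numq r * d] and is prime to [numq r], so it divides [d]. *)
rewrite -(@Gauss_dvdzr _ (numq r)); first by rewrite (numq_cross rd) dvdz_mull.
by rewrite coprimezE coprime_sym; apply: coprime_num_den.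
Qed.

Fact p_integral_subring : subring_closed p_integral.
Proof.
split=> [|r s /p_integralP[d pd [n rd]] /p_integralP[e pe [m se]]
        |r s /p_integralP[d pd [n rd]] /p_integralP[e pe [m se]]].
- by rewrite inE coprimen1.
- apply/p_integralP; exists (d * e); first by rewrite abszM coprimeMr pd.
  by exists (n * e - m * d); rewrite rmorphB !rmorphM /= -rd -se; ring.
- apply/p_integralP; exists (d * e); first by rewrite abszM coprimeMr pd.
  by exists (n * m); rewrite !rmorphM /= -rd -se; ring.
Qed.

HB.instance Definition _ :=
  GRing.isSubringClosed.Build rat p_integral p_integral_subring.

Record localization := Localization {
  rat_of_loc :> rat;
  rat_of_loc_integral : rat_of_loc \in p_integral }.

HB.instance Definition _ := [isSub for rat_of_loc].
HB.instance Definition _ := [Choice of localization by <:].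
HB.instance Definition _ := [SubChoice_isSubComNzRing of localization by <:].

Variable F : fieldType.
Hypothesis pF : p \in [pchar F].

Lemma intr_neq0_pchar (d : int) : (d%:~R != 0 :> F) = coprime p `|d|.
Proof.
by rewrite prime_coprime ?(pcharf_prime pF) // -(dvdz_pcharf pF) dvdzE.
Qed.

(** [ratr] divides numerator by denominator, which respects the ring operations here because these
    denominators stay nonzero in [F]. The membership proof is an argument for the same reason as in
    [quad_eval]. *)
Definition loc_eval of p \in [pchar F] :=
  fun r : localization => ratr (val r) : F.

(** The value can be read off any fraction with denominator prime to [p], so the morphism laws are
    checked over a common denominator. *)
Lemma loc_evalE (r : localization) (d n : int) :
  coprime p `|d| -> val r * d%:~R = n%:~R -> loc_eval pF r * d%:~R = n%:~R.
Proof.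
move=> pd rd; have den0 : (denq (val r))%:~R != 0 :> F.
  by rewrite intr_neq0_pchar; apply: (valP r).
apply: (mulIf den0); rewrite -rmorphM /= -(numq_cross rd) rmorphM /=.
by rewrite /loc_eval /ratr mulrAC divfK.
Qed.

Fact loc_eval_zmod : zmod_morphism (loc_eval pF).
Proof.
move=> r s; have /p_integralP[d pd [n rd]] := valP r.
have /p_integralP[e pe [m se]] := valP s.
have pde : coprime p `|d * e| by rewrite abszM coprimeMr pd.
have de0 : (d * e)%:~R != 0 :> F by rewrite intr_neq0_pchar.
apply: (mulIf de0); rewrite (loc_evalE (n := n * e - m * d)) //.
  by rewrite rmorphB !rmorphM /= -(loc_evalE pd rd) -(loc_evalE pe se); ring.
by rewrite !rmorphB !rmorphM /=; move: rd se => /= <- <-; ring.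
Qed.

Fact loc_eval_monoid : monoid_morphism (loc_eval pF).
Proof.
split=> [|r s].
  rewrite -[LHS]mulr1; apply: (@loc_evalE 1 1 1).
    exact: coprimen1.
  exact: mulr1.
have /p_integralP[d pd [n rd]] := valP r.
have /p_integralP[e pe [m se]] := valP s.
have pde : coprime p `|d * e| by rewrite abszM coprimeMr pd.
have de0 : (d * e)%:~R != 0 :> F by rewrite intr_neq0_pchar.
apply: (mulIf de0); rewrite (loc_evalE (n := n * m)) //.
  by rewrite !rmorphM /= -(loc_evalE pd rd) -(loc_evalE pe se); ring.
by rewrite !rmorphM /=; move: rd se => /= <- <-; ring.
Qed.

HB.instance Definition _ :=
  GRing.isZmodMorphism.Build _ _ (loc_eval pF) loc_eval_zmod.
HB.instance Definition _ :=
  GRing.isMonoidMorphism.Build _ _ (loc_eval pF) loc_eval_monoid.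
End Localization.

(** * Existence of reductions at the good primes *)

Lemma sqrt_finField p n : prime p ->
  exists (F : finFieldType) (s : F), p \in [pchar F] /\ s ^+ 2 = n%:R.
Proof.
move=> p_pr; pose q : {poly 'F_p} := 'X^2 - n%:R%:P.
have q0 : q != 0 by rewrite -size_poly_gt0 size_XnsubC.
(* [L] splits [q]; the list of roots cannot be empty since [q] has degree 2. *)
have [L [[|z rs] q_split _]] := FinSplittingFieldFor q0.
  move/eqp_size: q_split; rewrite size_map_poly size_XnsubC //.
  by rewrite big_nil size_poly1.
exists (FinFieldExtType L), z; split.
  by rewrite pchar_lalg pchar_Fp.
have : root (map_poly (GRing.in_alg L) q) z.
  by rewrite (eqp_root q_split) big_cons rootM root_XsubC eqxx.
rewrite /root rmorphB rmorphXn /= map_polyX map_polyC !hornerE subr_eq0.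
move/eqP->.
by rewrite raddfMn /= scale1r.
Qed.

(** The 5-adic valuation of [numq r ^+ 2] is even, that of [5 * denq r ^+ 2] odd. *)
Lemma rat_sqr_neq5 (r : rat) : r ^+ 2 != 5.
Proof.
apply/eqP=> r5; have num2 : numq r ^+ 2 = 5 * denq r ^+ 2.
  apply/eqP; rewrite -(eqr_int rat) rmorphXn rmorphM rmorphXn /=.
  by rewrite numqE exprMn r5.
move/(congr1 (fun z => odd (logn 5 `|z|))): num2.
rewrite abszM !abszX lognM ?expn_gt0 ?absz_gt0 ?denq_neq0 //.
by rewrite !lognX !mul2n oddD !odd_double.
Qed.

Section Exists.
Variables (p : nat) (p_pr : prime p).
Let L := localization p.

Definition loc_algC (r : L) : algC := ratr (val r).
HB.instance Definition _ :=
  GRing.RMorphism.copy loc_algC (ratr \o val : L -> algC).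

Lemma sqrt5_loc : sqrtC 5 ^+ 2 = loc_algC 5.
Proof. by rewrite sqrtCK rmorph_nat. Qed.

(** A kernel element with [v] nonzero would make [- u / v] a rational square root of 5. *)
Lemma quad_eval_sqrt5_inj : injective (quad_eval sqrt5_loc).
Proof.
apply: raddf_inj => -[u v] uv0.
have {}uv0 : ratr (rat_of_loc u) + ratr (rat_of_loc v) * sqrtC 5 = 0 :> algC.
  exact: uv0.
have [v0|v0] := eqVneq (rat_of_loc v) 0.
  rewrite v0 rmorph0 mul0r addr0 in uv0.
  by move/eqP: uv0; rewrite fmorph_eq0 => /eqP u0; congr pair; apply: val_inj.
have /eqP[] := rat_sqr_neq5 (- rat_of_loc u / rat_of_loc v).
apply: (fmorph_inj (ratr : rat -> algC)); rewrite rmorphXn rmorph_nat /=.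
rewrite -[RHS]sqrtCK; congr (_ ^+ 2); rewrite rmorphM fmorphV rmorphN.
have v0C : ratr (rat_of_loc v) != 0 :> algC by rewrite fmorph_eq0.
apply: (mulIf v0C); rewrite mulfVK // mulrC; apply/esym/eqP.
by rewrite -addr_eq0 addrC uv0.
Qed.

Lemma loc_inv n : coprime p n -> exists r : L, n%:R * r = 1.
Proof.
move=> pn; have n0 : n%:R != 0 :> rat.
  rewrite pnatr_eq0; apply: contraTneq pn => ->.
  by rewrite /coprime gcdn0 gtn_eqF ?prime_gt1.
have pr : n%:R^-1 \in p_integral p.
  by apply/p_integralP; exists n%:Z => //; exists 1; rewrite mulVf.
exists (Localization pr); apply: val_inj.
by rewrite rmorphM rmorph_nat /= mulfV.
Qed.

Lemma reduction_exists P : p \notin bad_primes P -> reduction_defined P p.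
Proof.
move=> p_good; have [F [s [pF s5]]] := sqrt_finField 5 p_pr.
have s5F : s ^+ 2 = loc_eval pF 5 by rewrite s5 rmorph_nat.
pose A := quad (5 : L).
suff [a [b [aE bE]]] : exists a b : A,
    quad_eval sqrt5_loc a = cos_face P /\
    quad_eval sqrt5_loc b = cos_dihedral P.
  exists F, (quad_eval s5F a), (quad_eval s5F b); split=> //.
  exists A, (quad_eval sqrt5_loc), (quad_eval s5F), a, b; split=> //.
  exact: quad_eval_sqrt5_inj.
(* Only bad primes divide the denominators of the cosines, and [p] differs from each of them. *)
have inv q : prime q -> p != q -> exists r : L, loc_algC r = q%:R^-1.
  move=> q_pr pq; have [|r r1] := @loc_inv q.
    by rewrite prime_coprime // dvdn_prime2.
  exists r.
  have q0 : q%:R != 0 :> algC by rewrite pnatr_eq0 -lt0n prime_gt0.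
  apply: (mulfI q0).
  by rewrite mulfV // -(rmorph_nat loc_algC) -rmorphM r1 rmorph1.
have e0 : loc_algC 0 = 0 by rewrite rmorph0.
(* Below, [h] and [t] are the inverses of the two bad primes, and pairs are coordinates with respect
   to 1 and the square root of 5. *)
rewrite /quad_eval; case: P p_good; rewrite /= ?inE ?negb_or.
- case/andP=> /inv-/(_ isT)[h hE] /inv-/(_ isT)[t tE].
  by exists (h, 0), (t, 0); rewrite /= e0 hE tE !mul0r !addr0 !mul1r.
- by exists 0, 0; rewrite /= e0 mul0r addr0.
- case/andP=> /inv-/(_ isT)[h hE] /inv-/(_ isT)[t tE].
  exists (h, 0), (- t, 0).
  by rewrite /= e0 rmorphN /= hE tE !mul0r !addr0 !mul1r.
- case/andP=> /inv-/(_ isT)[h hE] /inv-/(_ isT)[t tE].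
  exists (h * h, - (h * h)), (0, - t).
  by rewrite /= e0 !(rmorphN, rmorphM) /= hE tE; split; field.
case/andP=> /inv-/(_ isT)[h hE] /inv-/(_ isT)[t tE].
by exists (h, 0), (0, - t); rewrite /= e0 rmorphN /= hE tE; split; field.
Qed.
End Exists.

Theorem proposition3p1 (P : polyhedron) (p : nat) (p_prime : prime p) :
  (reduction_defined P p <-> p \notin bad_primes P) /\
  (forall (F : finFieldType) (x y : F),
     p \in [pchar F] -> polyhedron_reduction P x y ->
     (P = Cube /\ p = 2%N -> aut_group x y \isog 'Sym_('I_3)) /\
     (~ (P = Cube /\ p = 2%N) -> isog_classical_aut P (aut_group x y))).
Proof.
have neq_char (F : finFieldType) q :
    p \in [pchar F] -> q%:R != 0 :> F -> p != q.
  by move=> pF; apply: contraNneq => <-; rewrite pcharf0.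
split.
  split=> [[F [x [y [pF /cos_relations_reduction rel]]]]|]; last first.
    exact: reduction_exists.
  have {}neq_char q := neq_char F q pF.
  (* For each bad prime the relations give an inverse in [F], so it is not the characteristic. *)
  case: P rel => /=; rewrite ?inE ?negb_or //.
  - by case=> /mulr_eq1_neq0 F2 /mulr_eq1_neq0 F3; rewrite !neq_char.
  - case=> /mulr_eq1_neq0 F2 y3; rewrite !neq_char //.
    by apply: (@mulr_eq1_neq0 _ _ (- y)); rewrite mulrN y3 opprK.
  - case=> x2 _ /mulr_eq1_neq0 F5; rewrite !neq_char //.
    exact: dodecahedron_char_neq2 x2.
  - case=> x2 yy; rewrite !neq_char ?(mulr_eq1_neq0 x2) //.
    exact: icosahedron_char_neq3 x2 yy.
move=> F x y pF /cos_relations_reduction rel.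
split=> [[PE p2]|nCube2].
  by apply: isog_Cube2; [rewrite p2 in pF; apply: pcharf0 | rewrite -PE].
case: P rel nCube2 => rel nCube2.
- exact: isog_Tetrahedron.
(* If 2 vanished in [F], then [p] would be 2, the excluded case. *)
- apply: isog_Cube => //; apply/negP; rewrite -(dvdn_pcharf pF).
  by rewrite dvdn_prime2 // => /eqP p2; case: nCube2.
- exact: isog_Octahedron.
- apply: isog_Dodecahedron => //; case: rel => x2 _ _.
  exact: dodecahedron_char_neq2 x2.
- exact: isog_Icosahedron.
Qed.
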